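(* There is no finite group $G$ whose directed power graph $\overrightarrow{\mathcal{P}}(G)$ is (isomorphic to) a directed Cayley graph of some group.
   Context: For a finite group $G$, the directed power graph $\overrightarrow{\mathcal{P}}(G)$ is the digraph with vertex set $G$ having an arc from $x$ to $y$ if and only if $x\neq y$ and $y=x^m$ for some positive integer $m$. For a group $H$ and a subset $C\subseteq H\setminus\{e\}$, the directed Cayley graph $\overrightarrow{X}(H,C)$ has vertex set $H$ and arc set $\{(g,h): g^{-1}h\in C\}$ (the subset $C$ may be empty).
   Formalization: The finite group G is assumed nontrivial: for the trivial group the directed power graph is a single vertex without arcs, which is the directed Cayley graph of the trivial group with C empty, so the claim as worded fails there. *)

(* Defs.v *)
From HB Require Import structures.
From mathcomp Require Import all_boot all_fingroup.

Set Implicit Arguments.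
Unset Strict Implicit.
Unset Printing Implicit Defensive.

Local Open Scope group_scope.

Record digraph := Digraph {
  vertex : Type;
  arrow : vertex -> vertex -> Prop
}.

Definition digraph_iso (D E : digraph) : Prop :=
  exists2 f : vertex D -> vertex E,
    bijective f & forall x y, arrow x y <-> arrow (f x) (f y).

Definition power_digraph (G : finGroupType) : digraph :=
  @Digraph G (fun x y => x <> y /\ exists2 m : nat, (0 < m)%N & y = x ^+ m).

(* The condition that the identity is not in C is imposed in
   [is_cayley_digraph]; C may be empty. *)
Definition cayley_digraph (H : groupType) (C : H -> Prop) : digraph :=
  @Digraph H (fun g h => C (g^-1 * h)).

(* H ranges over all groups, with no finiteness assumption. *)
Definition is_cayley_digraph (D : digraph) : Prop :=
  exists (H : groupType) (C : H -> Prop),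
    ~ C 1 /\ digraph_iso D (cayley_digraph C).

(* Main.v *)
(* In a Cayley digraph every vertex has out-degree |C|.  In the power digraph
   the identity has no out-arc, while every x <> 1 has the arc x -> x^#[x] = 1. *)
Require Import Defs.
From mathcomp Require Import all_boot all_fingroup.

(** In a Cayley digraph the label of any one arc gives an arc out of every vertex. The arc from a
    nontrivial element to the identity thus forces an arc out of the identity, whose powers are all
    trivial. *)

(* The trivial group has to be excluded: its power digraph is one vertex
   without arcs, i.e. the Cayley digraph of the trivial group with C empty. *)
Theorem theorem2p1 :
  ~ exists G : finGroupType,
      1 < #|[set: G]| /\ is_cayley_digraph (power_digraph G).
Proof.
move=> [G [/card_gt1P [a [b [_ _ neq_ab]]] [H [C [_ [f bij_f arrow_f]]]]]].
have [g _ fK] := bij_f.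
have [x neq_x1]: exists x : G, x <> 1%g.
  have [a1|/eqP] := eqVneq a 1%g; last by exists a.
  by exists b => b1; rewrite a1 b1 eqxx in neq_ab.
have x_to_1: @arrow (power_digraph G) x 1%g.
  by split=> //; exists #[x]%g; rewrite ?order_gt0 ?expg_order.
have /= Cc := (arrow_f _ _).1 x_to_1.
(* The label [c] of the arc from [f x] to [f 1] lies in [C], so it also labels an arc from [f 1] to
   [f 1 * c], which [g] pulls back to [G]. *)
pose c := ((f x)^-1 * f 1)%g.
have: @arrow (power_digraph G) 1%g (g (f 1 * c)%g).
  by apply/arrow_f; rewrite fK /= mulKg.
(* The head of this arc is a power of 1, hence 1 itself, but loops are excluded. *)
by case=> neq [m _]; rewrite expg1n => /esym.
Qed.
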